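(* Let $n\in\mathbb{N}$ and partially order $\mathfrak{S}_n$ by the right weak Bruhat order. (1) If $P$ is a special plane poset with $n$ elements, then $\displaystyle\Theta(P)=\sum_{\sigma\in\mathfrak{S}_n,\ \sigma\leq\Psi_n(P)^{-1}}\sigma$. (2) Let $P$ be a special poset with $n$ elements. There exists $\tau\in\mathfrak{S}_n$ such that $S_P=\{\sigma\in\mathfrak{S}_n\mid\sigma\leq\tau\}$ if, and only if, $P$ is a special plane poset.
   Context: Permutations $\sigma\in\mathfrak{S}_n$ are written as words $\sigma(1)\ldots\sigma(n)$. Right weak Bruhat order: $\sigma\leq\tau$ if $\tau$ is obtained from $\sigma$ by a finite sequence of elementary transformations, each exchanging two adjacent letters $ij$ with $i<j$ of the word into $ji$. A double poset is a finite set with two partial orders $(P,\leq_1,\leq_2)$, up to isomorphism; it is special if $\leq_2$ is total, and then, if it has $n$ elements, $(P,\leq_2)$ is identified with $\{1,\ldots,n\}$ with its usual order. The set $S_P$ of linear extensions of $P$ is the set of $\sigma\in\mathfrak{S}_n$ such that, for all $i,j$, $i<_1 j$ implies $\sigma^{-1}(i)<\sigma^{-1}(j)$, and $\Theta(P)=\sum_{\sigma\in S_P}\sigma$, an element of the vector space ($\mathbf{FQSym}$) over a field $\mathbb{K}$ with basis $\bigsqcup_n\mathfrak{S}_n$. A plane poset is a double poset $(P,\leq_h,\leq_r)$ such that two distinct elements are comparable for $\leq_h$ if and only if they are not comparable for $\leq_r$. Its induced total order is $x\leq y$ iff ($x\leq_h y$ or $x\leq_r y$). A special plane poset is a special poset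 isomorphic to $(P,\leq_h,\leq)$ for some plane poset $(P,\leq_h,\leq_r)$; this gives a bijection between plane posets and special plane posets (up to isomorphism). The map $\Phi_n$ from $\mathfrak{S}_n$ to the set $\mathcal{PP}(n)$ of isoclasses of plane posets with $n$ elements sends $\sigma$ to $(\{1,\ldots,n\},\leq_h,\leq_r)$ with $i\leq_h j$ iff ($i\leq j$ and $\sigma(i)\leq\sigma(j)$) and $i\leq_r j$ iff ($i\leq j$ and $\sigma(i)\geq\sigma(j)$). It is a bijection; $\Psi_n:\mathcal{PP}(n)\to\mathfrak{S}_n$ denotes its inverse, and $\Psi_n(P)$ for a special plane poset $P$ means $\Psi_n$ of the corresponding plane poset. *)

(* Defs.v *)
From mathcomp Require Import all_boot all_fingroup all_algebra.
From mathcomp Require Import monalg.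

Set Implicit Arguments.
Unset Strict Implicit.
Unset Printing Implicit Defensive.

Import GRing.Theory.

Definition partial_order (T : Type) (le : rel T) : Prop :=
  [/\ reflexive le, antisymmetric le & transitive le].

(* Double posets with n elements. *)
Record doublePoset (n : nat) := DoublePoset {
  dp_sort :> finType;
  dp_card : #|dp_sort| = n;
  le1 : rel dp_sort;
  le2 : rel dp_sort;
  le1_po : partial_order le1;
  le2_po : partial_order le2
}.

Arguments le1 {n d} x y.
Arguments le2 {n d} x y.

Record specialPoset (n : nat) := SpecialPoset {
  sp_dp :> doublePoset n;
  sp_total : total (@le2 n sp_dp)
}.

(* Here le1 is the order <=_h and le2 is the order <=_r. *)
Record planePoset (n : nat) := PlanePoset {
  pp_dp :> doublePoset n;
  pp_plane : forall x y : pp_dp, x != y ->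
    (le1 x y || le1 y x) = ~~ (le2 x y || le2 y x)
}.

Definition isomorphic m n (P : doublePoset m) (Q : doublePoset n) : bool :=
  [exists f : {ffun P -> Q},
    [&& injectiveb f, [forall y : Q, y \in codom f]
      & [forall x, forall y,
          (le1 (f x) (f y) == le1 x y) && (le2 (f x) (f y) == le2 x y)]]].

Lemma isomorphicP m n (P : doublePoset m) (Q : doublePoset n) :
  reflect (exists f : P -> Q, [/\ bijective f,
             {mono f : x y / le1 x y} & {mono f : x y / le2 x y}])
          (isomorphic P Q).
Proof.
apply: (iffP existsP) => [[f /and3P[/injectiveP fI /forallP fS /forallP fM]]|].
  exists f; split=> [|x y|x y].
  - apply: (inj_card_bij fI).
    rewrite -(card_codom fI); apply/subset_leq_card/subsetP=> y _; exact: fS.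
  - by have /forallP/(_ y)/andP[/eqP] := fM x.
  - by have /forallP/(_ y)/andP[_ /eqP] := fM x.
case=> f [[g fK gK] f1 f2]; exists (finfun f); apply/and3P; split.
- by apply/injectiveP=> x y; rewrite !ffunE; apply: (can_inj fK).
- by apply/forallP=> y; apply/codomP; exists (g y); rewrite ffunE gK.
- by apply/forallP=> x; apply/forallP=> y; rewrite !ffunE f1 f2 !eqxx.
Qed.

Definition rank (T : finType) (le : rel T) (x : T) : nat :=
  #|[pred y | le y x && (y != x)]|.

Lemma rank_lt (T : finType) (le : rel T) n (Tn : #|T| = n) x :
  rank le x < n.
Proof.
rewrite -Tn; apply: proper_card; apply/properP; split; first exact/subsetP.
by exists x; rewrite ?inE ?eqxx ?andbF.
Qed.

Definition ord_rank n (T : finType) (Tn : #|T| = n) (le : rel T) (x : T) :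
  'I_n := Ordinal (rank_lt le Tn x).

Lemma rank_mono (T : finType) (le : rel T) :
  partial_order le -> total le -> {mono rank le : x y / le x y >-> x <= y}.
Proof.
case=> leR leA leT leTot.
have lt x y : le x y -> x != y -> rank le x < rank le y.
  move=> xy nxy; apply: proper_card; apply/properP; split.
    apply/subsetP=> z; rewrite !inE => /andP[zx nzx].
    rewrite (leT _ _ _ zx xy) /=; apply: contra nxy => /eqP zy.
    by apply/eqP/leA; rewrite xy -zy zx.
  by exists x; rewrite !inE ?xy ?nxy ?eqxx ?andbF.
move=> x y; apply/idP/idP => [|xy].
  have /orP[//|yx] := leTot x y.
  have [-> _|nxy] := eqVneq x y; first exact: leR.
  by rewrite leqNgt lt // eq_sym.
by have [->//|nxy] := eqVneq x y; rewrite ltnW // lt.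
Qed.

Lemma ord_rank_bij n (T : finType) (Tn : #|T| = n) (le : rel T) :
  partial_order le -> total le -> bijective (ord_rank Tn le).
Proof.
move=> leP leTot; have leM := rank_mono leP leTot; case: leP => _ leA _.
apply: inj_card_bij; last by rewrite card_ord Tn.
by move=> x y [exy]; apply: leA; rewrite -!leM exy leqnn.
Qed.

(* The identification of a special poset with {1, ..., n}, here 'I_n. *)
Definition label n (P : specialPoset n) (x : P) : 'I_n :=
  ord_rank (dp_card P) (@le2 n P) x.

Lemma label_bij n (P : specialPoset n) : bijective (@label n P).
Proof. exact: ord_rank_bij (le2_po P) (@sp_total n P). Qed.

Lemma label_mono n (P : specialPoset n) :
  {mono @label n P : x y / le2 x y >-> x <= y}.
Proof. exact: rank_mono (le2_po P) (@sp_total n P). Qed.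

Definition linext n (P : specialPoset n) : {set 'S_n} :=
  [set s : 'S_n | [forall x : P, forall y : P,
     le1 x y && (x != y) ==> ((s^-1)%g (label x) < (s^-1)%g (label y))]].

Definition FQSym (K : fieldType) := {malg K[{n : nat & 'S_n}]}.

Definition FQSym_basis (K : fieldType) n (s : 'S_n) : FQSym K :=
  << Tagged (fun m : nat => 'S_m) s >>%R.

Definition Theta (K : fieldType) n (P : specialPoset n) : FQSym K :=
  (\sum_(s in linext P) FQSym_basis K s)%R.

Section PlaneTotal.
Variables (T : finType) (h r : rel T).
Hypotheses (h_po : partial_order h) (r_po : partial_order r).
Hypothesis plane : forall x y, x != y -> (h x y || h y x) = ~~ (r x y || r y x).

Lemma plane_union_po : partial_order (relU h r).
Proof.
case: h_po r_po => hR hA hT [rR rA rT]; split=> [x|x y|y x z] /=.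
- by rewrite hR.
- have [//|nxy] := eqVneq x y.
  case/andP=> /orP[] p /orP[] q; try by [apply: hA; rewrite p q | apply: rA; rewrite p q].
    by have := plane nxy; rewrite p q orbT.
  by have := plane nxy; rewrite p q orbT.
have [->//|nxy] := eqVneq x y.
have [->//|nyz] := eqVneq y z.
have [<-|nxz] := eqVneq x z; first by rewrite hR.
have [pxy pyz pxz] := And3 (plane nxy) (plane nyz) (plane nxz).
case/orP=> p /orP[] q.
- by rewrite (hT _ _ _ p q).
- have [//|nhxz] := boolP (h x z); have [//|nrxz] := boolP (r x z).
  move: pxz; rewrite (negbTE nhxz) (negbTE nrxz) /=.
  have [zx _|_ /esym/negbFE zx] := boolP (h z x); last first.
    by move: pxy; rewrite (rT _ _ _ q zx) p orbT.
  by move: pyz; rewrite (hT _ _ _ zx p) q orbT.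
- have [//|nhxz] := boolP (h x z); have [//|nrxz] := boolP (r x z).
  move: pxz; rewrite (negbTE nhxz) (negbTE nrxz) /=.
  have [zx _|_ /esym/negbFE zx] := boolP (h z x); last first.
    by move: pyz; rewrite (rT _ _ _ zx p) q orbT.
  by move: pxy; rewrite (hT _ _ _ q zx) p orbT.
- by rewrite (rT _ _ _ p q) orbT.
Qed.

Lemma plane_union_total : total (relU h r).
Proof.
move=> x y /=; have [->|/plane] := eqVneq x y; first by case: h_po => ->.
by case: (h x y); case: (h y x); case: (r x y); case: (r y x).
Qed.

End PlaneTotal.

(* The special poset (P, <=_h, <=) attached to the plane poset
   (P, <=_h, <=_r). *)
Definition special_of n (Q : planePoset n) : specialPoset n :=
  @SpecialPoset n
    (DoublePoset (dp_card Q) (le1_po Q)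
       (plane_union_po (le1_po Q) (le2_po Q) (@pp_plane n Q)))
    (plane_union_total (le1_po Q) (@pp_plane n Q)).

Definition corresponds n (P : specialPoset n) (Q : planePoset n) : Prop :=
  isomorphic P (special_of Q).

Definition special_plane n (P : specialPoset n) : Prop :=
  exists Q : planePoset n, corresponds P Q.

Section Phi.
Variables (n : nat) (s : 'S_n).

Definition Phi_h : rel 'I_n := fun i j => (i <= j) && (s i <= s j).
Definition Phi_r : rel 'I_n := fun i j => (i <= j) && (s j <= s i).

Lemma Phi_h_po : partial_order Phi_h.
Proof.
split=> [i|i j|j i k]; rewrite /Phi_h ?leqnn //.
  case/andP=> /andP[ij _] /andP[ji _].
  by apply/val_inj/anti_leq; rewrite ij ji.
case/andP=> p q /andP[p' q'].
by rewrite (leq_trans p p') (leq_trans q q').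
Qed.

Lemma Phi_r_po : partial_order Phi_r.
Proof.
split=> [i|i j|j i k]; rewrite /Phi_r ?leqnn //.
  case/andP=> /andP[ij _] /andP[ji _].
  by apply/val_inj/anti_leq; rewrite ij ji.
case/andP=> p q /andP[p' q'].
by rewrite (leq_trans p p') (leq_trans q' q).
Qed.

Lemma Phi_plane (i j : 'I_n) : i != j ->
  (Phi_h i j || Phi_h j i) = ~~ (Phi_r i j || Phi_r j i).
Proof.
move=> nij; rewrite /Phi_h /Phi_r.
have: (i : nat) != j by [].
have: (s i : nat) != s j by apply: contra nij => /eqP/val_inj/perm_inj->.
by case: (ltngtP i j); case: (ltngtP (s i) (s j)).
Qed.

Definition Phi : planePoset n :=
  @PlanePoset n (DoublePoset (card_ord n) Phi_h_po Phi_r_po) Phi_plane.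

End Phi.

Lemma Phi_surj n (Q : planePoset n) : exists s : 'S_n, isomorphic (Phi s) Q.
Proof.
have [hP rP pl] := And3 (le1_po Q) (le2_po Q) (@pp_plane n Q).
pose r' : rel Q := fun x y => le2 y x.
have r'P : partial_order r'.
  case: rP => rR rA rT; split=> [x|x y|y x z]; first exact: rR.
    by rewrite andbC; apply: rA.
  by move=> yx zy; apply: rT zy yx.
have pl' (x y : Q) : x != y -> (le1 x y || le1 y x) = ~~ (r' x y || r' y x).
  by move/pl->; rewrite orbC.
have [p1 p2] := (plane_union_po hP rP pl, plane_union_po hP r'P pl').
have [t1 t2] := (plane_union_total hP pl, plane_union_total hP pl').
pose a := ord_rank (dp_card Q) (relU (@le1 n Q) le2).
pose b := ord_rank (dp_card Q) (relU (@le1 n Q) r').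
have aM (x y : Q) : (a x <= a y) = le1 x y || le2 x y by apply: rank_mono p1 t1 _ _.
have bM (x y : Q) : (b x <= b y) = le1 x y || le2 y x by apply: rank_mono p2 t2 _ _.
have [a' aK a'K] : bijective a by apply: ord_rank_bij.
have [b' bK _] : bijective b by apply: ord_rank_bij.
have sI : injective (b \o a').
  by move=> i j /= /(can_inj bK)/(can_inj a'K).
exists (perm sI); apply/isomorphicP; exists a'; split; first by exists a.
  move=> i j; rewrite /= /Phi_h !permE /= -{2}[i]a'K -{2}[j]a'K aM bM.
  have [->|nij] := eqVneq (a' i) (a' j); first by case: hP => -> .
  have: ~~ (le2 (a' i) (a' j) && le2 (a' j) (a' i)).
    by apply: contra nij => rij; case: rP => _ /(_ _ _ rij)/eqP.
  have := pl _ _ nij.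
  by case: (le1 (a' i) (a' j)); case: (le1 (a' j) (a' i));
   case: (le2 (a' i) (a' j)); case: (le2 (a' j) (a' i)).
move=> i j; rewrite /= /Phi_r !permE /= -{2}[i]a'K -{2}[j]a'K aM bM.
have [->|nij] := eqVneq (a' i) (a' j); first by case: hP rP => -> _ _ [->].
have: ~~ (le1 (a' i) (a' j) && le1 (a' j) (a' i)).
  by apply: contra nij => hij; case: hP => _ /(_ _ _ hij)/eqP.
have := pl _ _ nij.
by case: (le1 (a' i) (a' j)); case: (le1 (a' j) (a' i));
   case: (le2 (a' i) (a' j)); case: (le2 (a' j) (a' i)).
Qed.

Lemma rank_mono_bij (T U : finType) (le : rel T) (le' : rel U) (f : T -> U) :
  bijective f -> {mono f : x y / le x y >-> le' x y} ->
  forall x, rank le' (f x) = rank le x.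
Proof.
move=> [g fK gK] fM x; rewrite /rank -(card_image (can_inj fK)).
apply: eq_card => y; rewrite !inE -{1 2}[y]gK fM -[y in RHS]gK.
by rewrite (mem_image (can_inj fK)) inE (can_eq fK).
Qed.

Lemma rank_ord n (i : 'I_n) : rank (fun j k : 'I_n => j <= k) i = i.
Proof.
rewrite /rank -sum1_card -[RHS]card_ord -sum1_card.
rewrite (big_ord_widen n (fun=> 1)) ?(ltnW (ltn_ord i)) //.
by apply: eq_bigl => j; rewrite !inE andbC -(inj_eq val_inj) -ltn_neqAle.
Qed.

Lemma rank_perm n (s : 'S_n) i : rank (fun j k => s j <= s k) i = s i.
Proof.
rewrite -[RHS]rank_ord; apply/esym/(@rank_mono_bij _ _ _ _ s) => //.
by exists (s^-1)%g; [apply: permK | apply: permKV].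
Qed.

Lemma Phi_inj n (s t : 'S_n) : isomorphic (Phi s) (Phi t) -> s = t.
Proof.
case/isomorphicP=> f [fB f1 f2].
have fid i : f i = i.
  apply: val_inj; rewrite /= -[LHS]rank_ord -[RHS]rank_ord.
  apply: rank_mono_bij => // j k.
  have := f1 j k; have := f2 j k; rewrite /= /Phi_h /Phi_r.
  have := leq_total (t (f j)) (t (f k)); have := leq_total (s j) (s k).
  case: (j <= k); case: (f j <= f k) => //=.
    by case: (s j <= s k); case: (s k <= s j) => // _ _ ->.
  by case: (t (f j) <= t (f k)); case: (t (f k) <= t (f j)).
apply/permP=> i; apply: val_inj; rewrite /= -!rank_perm /rank.
apply: eq_card => j; rewrite !inE; congr (_ && _).
have := (f1 i j, f1 j i, f2 i j, f2 j i); rewrite !fid /= /Phi_h /Phi_r.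
by case/orP: (leq_total i j) => -> /= [[[ij ji] rij] rji]; rewrite (ji, rij).
Qed.

(* Psi is the inverse of Phi on isomorphism classes: Phi_Psi, Psi_Phi and
   Psi_iso below. *)
Definition Psi n (Q : planePoset n) : 'S_n := xchoose (Phi_surj Q).

Lemma Phi_Psi n (Q : planePoset n) : isomorphic (Phi (Psi Q)) Q.
Proof. exact: xchooseP (Phi_surj Q). Qed.

Lemma Psi_unique n (Q : planePoset n) s : isomorphic (Phi s) Q -> Psi Q = s.
Proof.
move=> /isomorphicP[f [fB f1 f2]].
have /isomorphicP[g [[g' gK g'K] g1 g2]] := Phi_Psi Q.
apply/esym/Phi_inj/isomorphicP; exists (g' \o f); split.
- by apply: bij_comp fB; exists g.
- move=> x y; have := g1 (g' (f x)) (g' (f y)); rewrite !g'K => E.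
  exact: etrans (esym E) (f1 x y).
- move=> x y; have := g2 (g' (f x)) (g' (f y)); rewrite !g'K => E.
  exact: etrans (esym E) (f2 x y).
Qed.

Lemma Psi_Phi n (s : 'S_n) : Psi (Phi s) = s.
Proof. by apply/Phi_inj/Phi_Psi. Qed.

Lemma Psi_iso n (Q R : planePoset n) : isomorphic Q R -> Psi Q = Psi R.
Proof.
move=> /isomorphicP[f [fB f1 f2]]; apply/esym/Psi_unique/isomorphicP.
have /isomorphicP[g [gB g1 g2]] := Phi_Psi Q.
exists (f \o g); split; first exact: bij_comp.
- by move=> x y; apply: etrans (f1 _ _) (g1 x y).
- by move=> x y; apply: etrans (f2 _ _) (g2 x y).
Qed.

(* t is obtained from s by exchanging two adjacent letters s i < s j of the
   word of s; recall that (tperm i j * s) k = s (tperm i j k). *)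
Definition elementary n : rel 'S_n := fun s t =>
  [exists i : 'I_n, exists j : 'I_n,
    [&& j == i.+1 :> nat, s i < s j & t == (tperm i j * s)%g]].

Definition weak_le n : rel 'S_n := connect (@elementary n).

(* Main.v *)
Require Import Defs.
From mathcomp Require Import all_boot all_fingroup all_algebra.
From mathcomp Require Import monalg.
From mathcomp Require Import zify.

Set Implicit Arguments.
Unset Strict Implicit.
Unset Printing Implicit Defensive.

Import GroupScope.

(** Record a permutation [s] by its ascents: the pairs of letters [a < b] with
    [a] before [b] in the word of [s].  An elementary transformation removes
    exactly one pair from this set, so going up in the weak order shrinks it.
    Conversely, if the ascents of [t] are among those of [s] and [s != t],
    then some two adjacent letters of [s] form an ascent that [t] lacks, for
    otherwise [t] would order all letters as [s] does; exchanging them brings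
    [s] closer to [t].  So [s] lies below [t] exactly when the ascents of [t]
    are ascents of [s] ([weak_leE]).

    The condition that every ascent of [t] be an ascent of [s] says that [s]
    is a linear extension of the poset on [{1, ..., n}] whose strict relations
    are the ascents of [t], and this poset is the first order of
    [Phi t^-1].  Since labels identify a special plane poset attached to [Q]
    with the one attached to [Phi (Psi Q)] ([corresponds_label]), its linear
    extensions are the permutations below [(Psi Q)^-1] ([linext_weak_le]):
    this is (1), and one direction of (2).

    For the other direction, a partial order is the intersection of its linear
    extensions ([le1_linext]).  Hence a special poset whose linear extensions
    are the permutations below [t] has the same first order as the special
    plane poset attached to [Phi t^-1], and is isomorphic to it. *)

(** * The weak order and ascents *)

Section Ascents.
Variable n : nat.
Implicit Types (s t p : 'S_n) (i j a b : 'I_n).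

Definition ascents s : {set 'I_n * 'I_n} :=
  [set ab : 'I_n * 'I_n | (ab.1 < ab.2) && (s^-1 ab.1 < s^-1 ab.2)].

(** Exchanging two adjacent positions leaves the relative position of every
    other pair of letters unchanged. *)
Lemma ascents_tperm s i j : j = i.+1 :> nat -> s i < s j ->
  ascents (tperm i j * s) = ascents s :\ (s i, s j).
Proof.
move=> ij sij; apply/setP=> -[a b]; rewrite !inE /= invMg tpermV !permM.
rewrite -[a](permKV s) -[b](permKV s) !permK xpair_eqE !(inj_eq perm_inj).
move: (s^-1 a) (s^-1 b) => u v.
have val_neq (x y : 'I_n) : x <> y -> x != y :> nat by move=> /eqP.
case: tpermP => [->|->|/val_neq ui /val_neq uj];
  case: tpermP => [->|->|/val_neq vi /val_neq vj];
  rewrite ?eqxx ?ltnn ?andbF //= -?(inj_eq val_inj) /=.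
all: lia.
Qed.

Lemma increasing_perm1 p :
  (forall i j, j = i.+1 :> nat -> p i < p j) -> p = 1.
Proof.
move=> p_adj.
have p_lt : {homo p : i j / i < j}.
  move=> i [j jn] /=; elim: j jn => // j IHj jn.
  rewrite ltnS leq_eqVlt => /orP[/eqP ij|ij]; first by apply: p_adj; rewrite ij.
  exact: ltn_trans (IHj (ltnW jn) ij) (p_adj (Ordinal (ltnW jn)) _ _).
apply/permP=> i; apply: val_inj; rewrite perm1 /= -rank_perm -[RHS]rank_ord.
apply: eq_card => j; rewrite !inE; congr (_ && _); apply/idP/idP => [pji|].
  by rewrite leqNgt; apply/negP=> /p_lt; rewrite ltnNge pji.
by rewrite leq_eqVlt => /orP[/eqP/val_inj->|/p_lt/ltnW].
Qed.

(** If no adjacent ascent of [s] could be exchanged while staying below [t],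
    then [t^-1] would read the word of [s] in increasing order. *)
Lemma adjacent_ascent s t : ascents t \subset ascents s -> s != t ->
  exists i j, [/\ j = i.+1 :> nat, s i < s j & (s i, s j) \notin ascents t].
Proof.
move=> /subsetP sub_ts nst.
have [/existsP[i /existsP[j /and3P[/eqP]]]|none] :=
    boolP [exists i : 'I_n, exists j : 'I_n,
      [&& j == i.+1 :> nat, s i < s j & (s i, s j) \notin ascents t]].
  by exists i, j.
case/eqP: nst; apply/eqP; rewrite eq_mulgV1; apply/eqP.
apply: increasing_perm1 => i j ij; rewrite !permM.
have [sij|sji|/val_inj/perm_inj eij] := ltngtP (s i) (s j).
- move: none; rewrite negb_exists => /forallP/(_ i); rewrite negb_exists.
  by move/forallP/(_ j); rewrite ij eqxx sij negbK inE /= sij.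
- (* A descent of [s] is also one of [t]. *)
  rewrite ltnNge leq_eqVlt negb_or; apply/andP; split.
    by rewrite (inj_eq val_inj) !(inj_eq perm_inj) -(inj_eq val_inj) /=; lia.
  apply/negP=> tji; have := sub_ts (s j, s i).
  by rewrite !inE /= sji tji !permK => /(_ isT); lia.
- by move: ij; rewrite eij; lia.
Qed.

Lemma weak_leE s t : weak_le s t = (ascents t \subset ascents s).
Proof.
apply/idP/idP => [/connectP[w]|].
  elim: w s => [s _ ->//|u w IHw s /= /andP[su uw] /(IHw _ uw) tu].
  apply: subset_trans tu _.
  have /existsP[i /existsP[j /and3P[/eqP ij sij /eqP->]]] := su.
  by rewrite ascents_tperm // subsetDl.
have [m] := ubnP #|ascents s|; elim: m s => // m IHm s sm ts.
have [->|nst] := eqVneq s t; first exact: connect0.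
have [i [j [ij sij nt]]] := adjacent_ascent ts nst.
have sE := ascents_tperm ij sij.
apply: (connect_trans (y := tperm i j * s)).
  apply/connect1/existsP; exists i; apply/existsP; exists j.
  by rewrite ij sij !eqxx.
apply: IHm; last by rewrite sE subsetD1 ts.
rewrite -ltnS; apply: leq_trans sm.
rewrite sE ltnS [in ltnRHS](cardsD1 (s i, s j)).
by rewrite inE /= sij !permK ij ltnSn.
Qed.

End Ascents.

(** * Labels and linear extensions *)

Section LinearExtensions.
Variable n : nat.
Implicit Types (P : specialPoset n) (Q : planePoset n) (s t : 'S_n).

Lemma Phi_total s (i j : 'I_n) : Phi_h s i j || Phi_r s i j = (i <= j).
Proof. by rewrite /Phi_h /Phi_r -andb_orr leq_total andbT. Qed.

(** The second order of the special poset attached to [Phi s] is the usual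
    order of ['I_n], which has no automorphism, so that an isomorphism
    onto it can only be the labelling. *)
Lemma corresponds_label P Q : corresponds P Q ->
  {mono @label n P : x y / le1 x y >-> Phi_h (Psi Q) x y}.
Proof.
move=> /isomorphicP[f [fB f1 f2]].
have /isomorphicP[g [[g' gK g'K] g1 g2]] := Phi_Psi Q.
pose h (x : P) : 'I_n := g' (f x).
have h1 x y : Phi_h (Psi Q) (h x) (h y) = le1 x y.
  by rewrite -f1 -[f x]g'K -[f y]g'K; apply/esym/g1.
have h2 (x y : P) : (h x <= h y) = le2 x y.
  rewrite -f2 -(Phi_total (Psi Q)) /= -[f x]g'K -[f y]g'K.
  by congr (_ || _); apply/esym; [apply: g1 | apply: g2].
suff labelE x : label x = h x by move=> x y; rewrite !labelE h1.
apply: val_inj; rewrite /= -[RHS]rank_ord; apply/esym/rank_mono_bij => //.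
by apply: bij_comp fB; exists g.
Qed.

Lemma label_corresponds P s :
  {mono @label n P : x y / le1 x y >-> Phi_h s x y} -> corresponds P (Phi s).
Proof.
move=> labelM; apply/isomorphicP; exists (@label n P); split=> //.
  exact: label_bij.
by move=> x y; apply: etrans (Phi_total s _ _) (label_mono x y).
Qed.

Lemma linextP P s :
  reflect (forall x y : P, le1 x y -> x != y ->
             s^-1 (label x) < s^-1 (label y))
          (s \in linext P).
Proof.
rewrite inE; apply: (iffP forallP) => [sP x y xy nxy|sP x].
  by have /forallP/(_ y) := sP x; rewrite xy nxy.
by apply/forallP=> y; apply/implyP=> /andP[]; apply: sP.
Qed.

Lemma linext_weak_le P s :
  {mono @label n P : x y / le1 x y >-> Phi_h s x y} ->
  linext P = [set t | weak_le t s^-1].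
Proof.
move=> labelM; have [l labelK lK] := label_bij P.
apply/setP=> t; rewrite [RHS]inE weak_leE.
apply/linextP/subsetP => [tP [a b]|tP x y].
  rewrite !inE invgK /= => /andP[ab sab]; rewrite ab /=.
  rewrite -[a]lK -[b]lK; apply: tP.
    by rewrite -labelM !lK /Phi_h ltnW //= ltnW.
  by rewrite (can_eq lK) -(inj_eq val_inj) neq_ltn ab.
rewrite -labelM -(can_eq labelK); move: (label x) (label y) => a b.
move=> /andP[ab sab] nab; have := tP (a, b).
rewrite !inE invgK /= !ltn_neqAle ab sab.
by rewrite !(inj_eq val_inj) (inj_eq perm_inj) nab /= => /(_ isT)/andP[-> ->].
Qed.

Lemma perm_of_key (k : 'I_n -> nat) : injective k ->
  exists p : 'S_n, forall i j, (p i < p j) = (k i < k j).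
Proof.
move=> kI; pose le := [rel i j : 'I_n | k i <= k j].
have le_po : partial_order le.
  split=> [i|i j|j i m] /=; [exact: leqnn | | exact: leq_trans].
  by move/anti_leq/kI.
have le_tot : total le by move=> i j; apply: leq_total.
have [p' pK _] := ord_rank_bij (card_ord n) le_po le_tot.
exists (perm (can_inj pK)) => i j; rewrite !permE !ltnNge; congr (~~ _).
exact: (rank_mono le_po le_tot).
Qed.

(** The elements below [y] come first, and [x] is not one of them; within
    each of the two groups elements are sorted by the number of their strict
    predecessors, and ties are broken by labels. *)
Lemma linext_separate P (x y : P) : ~~ le1 x y ->
  exists2 s : 'S_n, s \in linext P & s^-1 (label y) < s^-1 (label x).
Proof.
move=> nxy; have [l labelK lK] := label_bij P.
have [leR leA leT] := le1_po P.
(* The three criteria are the digits of the key in base [n]. *)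
pose key (i : 'I_n) :=
  (~~ le1 (l i) y * n + rank (@le1 n P) (l i)) * n + i.
have rank_n z : rank (@le1 n P) z < n := rank_lt le1 (dp_card P) z.
have keyI : injective key.
  move=> i j /(congr1 (modn^~ n)).
  by rewrite !modnMDl !modn_small // => /val_inj.
have key_lt u v :
    ~~ le1 (l u) y * n + rank (@le1 n P) (l u)
      < ~~ le1 (l v) y * n + rank (@le1 n P) (l v) -> key u < key v.
  move=> uv; apply: (@leq_trans ((~~ le1 (l u) y * n
                                    + rank (@le1 n P) (l u)).+1 * n)).
    by rewrite mulSn [ltnRHS]addnC ltn_add2l.
  by apply: leq_trans (leq_addr _ _); rewrite leq_mul2r uv orbT.
have [p pE] := perm_of_key keyI; exists p^-1; last first.
  rewrite invgK pE; apply: key_lt; rewrite !labelK leR nxy mul0n mul1n add0n.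
  exact: ltn_addr.
apply/linextP=> u v uv nuv; rewrite invgK pE; apply: key_lt; rewrite !labelK.
rewrite -addnS leq_add //.
  rewrite leq_mul2r; apply/orP; right.
  have [vy|_] := boolP (le1 v y); last exact: leq_b1.
  by rewrite (leT _ _ _ uv vy).
apply: proper_card; apply/properP; split.
  apply/subsetP=> z; rewrite !inE => /andP[zu nzu].
  rewrite (leT _ _ _ zu uv) /=; apply: contra nuv => /eqP zv.
  by apply/eqP/leA; rewrite uv -zv zu.
by exists u; rewrite !inE ?uv ?nuv ?eqxx ?andbF.
Qed.

Lemma le1_linext P (x y : P) : x != y ->
  le1 x y <-> forall s, s \in linext P -> s^-1 (label x) < s^-1 (label y).
Proof.
move=> nxy; split=> [xy s /linextP|sP]; first exact.
by apply: contraT => /linext_separate[s /sP]; case: ltngtP.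
Qed.

(** The identity and [t] are the extreme elements below [t]: when both put
    [a] before [b], this pair is an ascent of [t], hence of everything below. *)
Lemma weak_le_forced t (a b : 'I_n) : a != b ->
  (forall s, weak_le s t -> s^-1 a < s^-1 b) <-> Phi_h t^-1 a b.
Proof.
move=> nab; split=> [sP|/andP[ab tab] s].
  have le1t : weak_le 1 t.
    rewrite weak_leE; apply/subsetP=> ij.
    by rewrite !inE invg1 !perm1 andbb => /andP[].
  have := sP _ le1t; rewrite /Phi_h invg1 !perm1 => /ltnW->.
  exact/ltnW/sP/connect0.
rewrite weak_leE => /subsetP/(_ (a, b)); rewrite !inE /= !ltn_neqAle ab tab.
by rewrite !(inj_eq val_inj) (inj_eq perm_inj) nab => /(_ isT).
Qed.

End LinearExtensions.

Theorem proposition4p4 (n : nat) :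
  (forall (K : fieldType) (P : specialPoset n) (Q : planePoset n),
     corresponds P Q ->
     Theta K P
       = (\sum_(s : 'S_n | weak_le s (Psi Q)^-1%g) FQSym_basis K s)%R)
  /\
  (forall P : specialPoset n,
     (exists t : 'S_n, linext P = [set s : 'S_n | weak_le s t])
     <-> special_plane P).
Proof.
split=> [K P Q /corresponds_label/linext_weak_le PE|P].
  by apply: eq_bigl => s; rewrite PE inE.
split=> [[t PE]|[Q /corresponds_label/linext_weak_le PE]]; last first.
  by exists (Psi Q)^-1.
exists (Phi t^-1); apply: label_corresponds => x y.
have [->|nxy] := eqVneq x y.
  by case: (le1_po P) => ->; rewrite /Phi_h !leqnn.
have [l labelK _] := label_bij P.
have nlxy : label x != label y by rewrite (can_eq labelK).
apply/idP/idP.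
  move/(weak_le_forced t nlxy) => sP; apply/le1_linext => // s.
  by rewrite PE inE; apply: sP.
move/(le1_linext nxy) => sP; apply/(weak_le_forced t nlxy) => s st.
by apply: sP; rewrite PE inE.
Qed.
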